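(* Let $\xi_0,\xi_1,\dots$ be nondegenerate i.i.d. complex random variables with $\mathbb{P}(\xi_0=0)=0$ and $\mathbb{E}\log(1+|\xi_0|)<\infty$, and let $K_n(z)=\sum_{k=0}^n\xi_kz^k$. Fix a positive integer $m$, let $N_n=n-m$ (so $D_n=m$ for all $n$), and let $\mu^K_{D_n}$ be the counting measure of zeros of $K_n^{(N_n)}$. Then $\frac{1}{m}\mu^K_{D_n}\to\delta_0$ in probability, and $$\mathcal{S}_n(\mu^K_{D_n})\to\mu_{f_m^K}\quad\text{in distribution},$$ where $\mu_{f_m^K}$ is the random counting measure of zeros of the random polynomial $f_m^K(z)=\sum_{k=0}^m\frac{\xi_k}{k!}z^k$.
   Context: For a polynomial $f$, $\mu_f=\sum_{z:\,f(z)=0}\delta_z$ is the counting measure of its zeros (with multiplicity). For $h>0$ and a measure $\nu$ on $\mathbb{C}$, $(\mathcal{S}_h\nu)(B)=\nu(B/h)$ for Borel $B$ (so $\mathcal{S}_n(\mu^K_{D_n})$ is the zero counting measure of $K_n^{(N_n)}(z/n)$). Convergence of random measures in probability (resp. in distribution) means that $\int\phi\,d\nu_n\to\int\phi\,d\nu$ in probability (resp. in distribution) for every smooth compactly supported test function $\phi$ on $\mathbb{C}$. *)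

(* Defs.v *)
From HB Require Import structures.
From mathcomp Require Import all_boot all_order all_algebra.
From mathcomp Require Import all_classical all_reals all_analysis.
From mathcomp Require Import complex.
Set Implicit Arguments. Unset Strict Implicit. Unset Printing Implicit Defensive.
Import Order.TTheory GRing.Theory Num.Theory.
Import numFieldNormedType.Exports.
Local Open Scope classical_set_scope.
Local Open Scope ring_scope.

Section defs.
Variable R : realType.

Definition toC (v : R * R) : R[i] := Complex v.1 v.2.

Definition cabs (v : R * R) : R := Num.sqrt (v.1 ^+ 2 + v.2 ^+ 2).

(* the complex zeros of a polynomial over C, listed with multiplicity
   (p = lead_coef p * prod_(z <- roots_of p) (X - z)) *)
Definition roots_of (p : {poly R[i]}) : seq R[i] :=
  sval (closed_field_poly_normal p).

Fixpoint dpart (ds : seq bool) (f : R -> R -> R) : R -> R -> R :=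
  match ds with
  | [::] => f
  | b :: ds' =>
      let g := dpart ds' f in
      if b then (fun x y => derive1 (fun t => g t y) x)
      else (fun x y => derive1 (fun t => g x t) y)
  end.

Definition smooth2 (f : R -> R -> R) : Prop :=
  forall ds : seq bool,
    continuous (fun v : R * R => dpart ds f v.1 v.2) /\
    (forall x y, derivable (fun t => dpart ds f t y) x 1 /\
                 derivable (fun t => dpart ds f x t) y 1).

Definition compact_support2 (f : R -> R -> R) : Prop :=
  exists M : R, forall x y, M < `|x| \/ M < `|y| -> f x y = 0.

Definition test_fun (f : R -> R -> R) : Prop := smooth2 f /\ compact_support2 f.

(* int phi d mu_p, mu_p the zero counting measure of p (with multiplicity);
   convention: 0 for the zero polynomial *)
Definition zero_int (f : R -> R -> R) (p : {poly R[i]}) : R :=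
  if p == 0 then 0 else \sum_(z <- roots_of p) (let: Complex x y := z in f x y).

(* int phi d (S_h mu_p) = int phi(h z) d mu_p(z) *)
Definition scaled_zero_int (h : R) (f : R -> R -> R) (p : {poly R[i]}) : R :=
  zero_int (fun x y => f (h * x) (h * y)) p.

Section prob.
Context (d : measure_display) (T : measurableType d) (P : probability T R).

Definition mutual_indep (X : nat -> T -> R * R) : Prop :=
  forall (I : seq nat) (B : nat -> set (R * R)),
    uniq I -> (forall i, measurable (B i)) ->
    P (\big[setI/setT]_(i <- I) (X i @^-1` B i)) =
    (\prod_(i <- I) P (X i @^-1` B i))%E.

Definition ident_distr (X : nat -> T -> R * R) : Prop :=
  forall k (B : set (R * R)), measurable B ->
    P (X k @^-1` B) = P (X 0%N @^-1` B).

Definition nondegenerate_rv (Y : T -> R * R) : Prop :=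
  ~ exists c : R * R, P (Y @^-1` [set c]) = 1%E.

Definition cvg_in_prob (Y : nat -> T -> R) (c : R) : Prop :=
  forall eps : R, 0 < eps ->
    (fun n => P [set w | eps < `|Y n w - c|]) @ \oo --> 0%E.

Definition cvg_in_distr (Y : nat -> T -> R) (Z : T -> R) : Prop :=
  forall g : R -> R, continuous g -> (exists M : R, forall x, `|g x| <= M) ->
    (fun n => (\int[P]_w (g (Y n w))%:E)%E) @ \oo --> (\int[P]_w (g (Z w))%:E)%E.
End prob.

Definition Kpoly (xi : nat -> R * R) (n : nat) : {poly R[i]} :=
  \poly_(k < n.+1) toC (xi k).

Definition fKpoly (xi : nat -> R * R) (m : nat) : {poly R[i]} :=
  \poly_(k < m.+1) (toC (xi k) / (k`!)%:R).

End defs.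

(* Main.v *)
(** Put [N = n - m].  The coefficients [xi_N, ..., xi_(N+m)] of [K_n^(N)] have
    the same joint law as [xi_0, ..., xi_m], so [K_n^(N)] may be replaced by a
    polynomial [\sum_j c_N(j) xi_j z^j] with deterministic weights.
    After division by [n!] the weights tend to [0] for [j < m] and to [1/m!]
    for [j = m], so the limit polynomial is [xi_m z^m / m!], all of whose zeros
    are [0].  After the substitution [z/n] and division by [N!] they tend to
    [1/j!], and the limit is [f_m^K].  Zeros depend continuously on the
    coefficients as long as the leading one, here a multiple of [xi_m], does
    not vanish in the limit; this gives almost sure convergence of the integral
    of the test function, hence convergence in distribution. *)

Require Import Defs.
From HB Require Import structures.
From mathcomp Require Import all_boot all_order all_algebra.
From mathcomp Require Import all_classical all_reals all_analysis.
From mathcomp Require Import measurable_realfun complex.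
Set Implicit Arguments.
Unset Strict Implicit.
Unset Printing Implicit Defensive.
Import Order.TTheory GRing.Theory Num.Theory.
Import numFieldNormedType.Exports.
Local Open Scope classical_set_scope.
Local Open Scope ring_scope.

(** * Coordinatewise limits of complex sequences *)

Section ComplexConvergence.
Variable R : realType.
Implicit Types (u v : nat -> R[i]) (k l z : R[i]).

(* [R[i]] carries no topology, so limits are taken coordinatewise. *)
Definition ccvg u l : Prop :=
  (complex.Re (u n) @[n --> \oo] --> complex.Re l) /\
  (complex.Im (u n) @[n --> \oo] --> complex.Im l).

Let normc z : R := ComplexField.Normc.normc z.

Lemma ccvg_cst l : ccvg (fun=> l) l.
Proof. by split; exact: cvg_cst. Qed.

Lemma ccvgD u v k l : ccvg u k -> ccvg v l -> ccvg (fun n => u n + v n) (k + l).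
Proof.
move=> [uk1 uk2] [vl1 vl2]; split; rewrite raddfD/=;
  under eq_fun do rewrite raddfD; exact: cvgD.
Qed.

Lemma ccvgM u v k l : ccvg u k -> ccvg v l -> ccvg (fun n => u n * v n) (k * l).
Proof.
case: k l => [a b] [c d] [/= u1 u2] [/= v1 v2].
have reM (x y : R[i]) : complex.Re (x * y) =
    complex.Re x * complex.Re y - complex.Im x * complex.Im y.
  by case: x y => [? ?] [].
have imM (x y : R[i]) : complex.Im (x * y) =
    complex.Re x * complex.Im y + complex.Im x * complex.Re y.
  by case: x y => [? ?] [].
split; rewrite ?reM ?imM.
- under eq_fun do rewrite reM.
  by apply: cvgB; apply: cvgM.
- under eq_fun do rewrite imM.
  by apply: cvgD; apply: cvgM.
Qed.

Lemma ccvg_sum (I : Type) (r : seq I) (F : I -> nat -> R[i]) (G : I -> R[i]) :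
  (forall i, ccvg (F i) (G i)) ->
  ccvg (fun n => \sum_(i <- r) F i n) (\sum_(i <- r) G i).
Proof.
move=> FG; elim: r => [|i r IH].
  by under eq_fun do rewrite big_nil; rewrite big_nil; exact: ccvg_cst.
by under eq_fun do rewrite big_cons; rewrite big_cons; exact: ccvgD.
Qed.

Lemma eq_ccvg u v l : (\forall n \near \oo, u n = v n) -> ccvg u l -> ccvg v l.
Proof.
move=> uv [u1 u2]; split.
- by apply: cvg_trans u1; apply: near_eq_cvg; apply: filterS uv => n /= ->.
- by apply: cvg_trans u2; apply: near_eq_cvg; apply: filterS uv => n /= ->.
Qed.

Lemma normcE z : normc z = Num.sqrt (complex.Re z ^+ 2 + complex.Im z ^+ 2).
Proof. by case: z. Qed.

Lemma normc_ge0 z : 0 <= normc z.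
Proof. by rewrite normcE sqrtr_ge0. Qed.

Lemma normc_eq0 z : (normc z == 0) = (z == 0).
Proof.
apply/eqP/eqP => [/ComplexField.Normc.eq0_normc//|->].
exact: ComplexField.Normc.normc0.
Qed.

Lemma cvg_normc u l : ccvg u l -> normc (u n) @[n --> \oo] --> normc l.
Proof.
move=> [u1 u2]; rewrite normcE; under eq_fun do rewrite normcE.
apply: continuous_cvg; first exact: sqrt_continuous.
by apply: cvgD; rewrite !expr2; under eq_fun do rewrite expr2; exact: cvgM.
Qed.

Lemma ccvg_normc0 u l : normc (u n - l) @[n --> \oo] --> (0 : R) -> ccvg u l.
Proof.
move=> u0.
have reB n : `|complex.Re (u n) - complex.Re l| <= normc (u n - l).
  rewrite -raddfB -sqrtr_sqr normcE ler_sqrt ?lerDl ?sqr_ge0//.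
  by rewrite addr_ge0 ?sqr_ge0.
have imB n : `|complex.Im (u n) - complex.Im l| <= normc (u n - l).
  rewrite -raddfB -sqrtr_sqr normcE ler_sqrt ?lerDr ?sqr_ge0//.
  by rewrite addr_ge0 ?sqr_ge0.
split; apply/cvgrPdist_lt => e e0; move/cvgrPdist_lt: u0 => /(_ e e0);
  apply: filterS => n; rewrite sub0r normrN ger0_norm ?normc_ge0// distrC;
  exact: le_lt_trans.
Qed.

Lemma normc_prod (s : seq R[i]) (F : R[i] -> R[i]) :
  normc (\prod_(x <- s) F x) = \prod_(x <- s) normc (F x).
Proof.
elim: s => [|x s IH]; first by rewrite !big_nil; exact: ComplexField.Normc.normc1.
by rewrite !big_cons -IH; exact: ComplexField.Normc.normcM.
Qed.

(** A smallest value of [F] on [s] works, every factor being at least as large. Applied to the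
    distances from a point to the roots, it bounds the distance to the nearest one. *)
Lemma seq_le_prod (T : eqType) (s : seq T) (F : T -> R) :
  (forall x, 0 <= F x) -> s != [::] ->
  exists2 x, x \in s & F x ^+ size s <= \prod_(y <- s) F y.
Proof.
move=> F0; elim: s => // a [|b s] IH _.
  by exists a; rewrite ?mem_head// big_seq1.
have [//|x xs xle] := IH.
rewrite big_cons [size _]/=.
have [ax|xa] := leP (F a) (F x).
  exists a; rewrite ?mem_head// exprS ler_wpM2l// (le_trans _ xle)//.
  by rewrite lerXn2r ?nnegrE.
exists x; first by rewrite inE xs orbT.
by rewrite exprS ler_pM// ?exprn_ge0// ltW.
Qed.

End ComplexConvergence.

(** * Algebra of the zero counting integral *)

Section ZeroIntegral.
Variable R : realType.
Implicit Types (p q : {poly R[i]}) (f : R -> R -> R) (z : R[i]).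

Let normc z : R := ComplexField.Normc.normc z.

Definition evalC f z : R := f (complex.Re z) (complex.Im z).

Lemma zero_intE f p : p != 0 -> zero_int f p = \sum_(z <- roots_of p) evalC f z.
Proof. by move=> /negbTE p0; rewrite /zero_int p0; apply: eq_bigr => -[]. Qed.

Lemma roots_ofP p : p = lead_coef p *: \prod_(z <- roots_of p) ('X - z%:P).
Proof. by rewrite /roots_of; case: closed_field_poly_normal. Qed.

(** The multiset of roots is unique, so any factorisation may replace the list chosen by
    [roots_of]. *)
Lemma zero_int_prod f (c : R[i]) (s : seq R[i]) : c != 0 ->
  zero_int f (c *: \prod_(z <- s) ('X - z%:P)) = \sum_(z <- s) evalC f z.
Proof.
move=> c0; set p := _ *: _.
have lp : lead_coef p = c.
  by rewrite lead_coefZ (monicP _) ?mulr1// monic_prod_XsubC.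
have p0 : p != 0 by rewrite -lead_coef_eq0 lp.
rewrite zero_intE//; apply: perm_big; apply: prod_XsubC_eq.
by have := roots_ofP p; rewrite lp => /(scalerI c0).
Qed.

(** Peels off one root in the induction on the degree. For [q = 0] it could fail, since the zero
    polynomial has integral 0 by convention. *)
Lemma zero_int_MXsubC f z q : q != 0 ->
  zero_int f (q * ('X - z%:P)) = evalC f z + zero_int f q.
Proof.
move=> q0; rewrite (zero_intE f q0) {1}(roots_ofP q) -mul_polyC -mulrA mul_polyC mulrC.
rewrite -(big_cons _ _ z (roots_of q) xpredT (fun x => 'X - x%:P)).
by rewrite zero_int_prod ?lead_coef_eq0// big_cons.
Qed.

Lemma zero_intZ f (c : R[i]) p : c != 0 -> zero_int f (c *: p) = zero_int f p.
Proof.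
move=> c0; have [->|p0] := eqVneq p 0; first by rewrite scaler0.
rewrite (zero_intE f p0) {1}(roots_ofP p) scalerA zero_int_prod//.
by rewrite mulf_neq0// lead_coef_eq0.
Qed.

Lemma zero_int_const f p : (size p <= 1)%N -> zero_int f p = 0.
Proof.
move=> sp; have [->|p0] := eqVneq p 0; first by rewrite /zero_int eqxx.
have [c pc] : exists c, p = c%:P by exists p`_0; exact: size1_polyC.
have c0 : c != 0 by move: p0; rewrite pc polyC_eq0.
have -> : p = c *: \prod_(z <- [::]) ('X - z%:P).
  by rewrite big_nil -mul_polyC mulr1.
by rewrite zero_int_prod// big_nil.
Qed.

(** The roots of [p(X / h)] are those of [p] multiplied by [h]. *)
Lemma zero_int_scale (h : R) f p : h != 0 ->
  scaled_zero_int h f p = zero_int f (p \Po (h^-1%:C%C *: 'X)).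
Proof.
move=> h0; have hC0 : h%:C%C != 0 :> R[i] by rewrite (inj_eq (@complexI R)).
rewrite /scaled_zero_int.
have [->|p0] := eqVneq p 0; first by rewrite comp_poly0 /zero_int eqxx.
rewrite zero_intE// {2}(roots_ofP p) comp_polyZ rmorph_prod/=.
(* Each factor satisfies [X / h - z = (X - h z) / h]; the powers of [1 / h] join the leading
   scalar. *)
have -> : \prod_(z <- roots_of p) (('X - z%:P) \Po (h^-1%:C%C *: 'X)) =
   (h^-1%:C%C ^+ size (roots_of p)) *:
     \prod_(z <- [seq h%:C%C * z | z <- roots_of p]) ('X - z%:P).
  elim: (roots_of p) => [|z s IH]; first by rewrite !big_nil expr0 scale1r.
  rewrite [map _ _]/= !big_cons IH exprS -!mul_polyC polyCM.
  have -> : ('X - z%:P) \Po ((h^-1)%:C%C%:P * 'X) =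
      (h^-1)%:C%C%:P * ('X - (h%:C%C * z)%:P).
    rewrite rmorphB/= comp_polyX comp_polyC mulrBr -[X in _ = _ - X]polyCM.
    by rewrite mulrA -rmorphM mulVf// mul1r.
  by rewrite !mulrA; congr (_ * _); rewrite -!mulrA; congr (_ * _); rewrite mulrC.
rewrite scalerA zero_int_prod.
  rewrite big_map; apply: eq_bigr => -[a b] _.
  by rewrite /evalC /= !mul0r subr0 addr0.
by rewrite mulf_neq0 ?lead_coef_eq0// expf_neq0// (inj_eq (@complexI R)) invr_eq0.
Qed.

(** The degree is exactly [m + 1], and the modulus of [p(z)] is that of the leading coefficient
    times the product of the distances from [z] to the roots; take the nearest root. *)
Lemma near_root m p z : (size p <= m.+2)%N -> p`_m.+1 != 0 ->
  exists2 x, root p x & normc (z - x) ^+ m.+1 * normc p`_m.+1 <= normc p.[z].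
Proof.
move=> sp pm.
have sp' : size p = m.+2.
  apply/eqP; rewrite eqn_leq sp/= ltnNge; apply: contra pm => sp'.
  by rewrite nth_default.
have lp : lead_coef p = p`_m.+1 by rewrite /lead_coef sp'.
have p0 : p != 0 by rewrite -size_poly_eq0 sp'.
have := roots_ofP p; set s := roots_of p => ps.
have ss : size s = m.+1.
  move: sp'; rewrite {1}ps size_scale ?lead_coef_eq0// size_prod_XsubC.
  by case.
have s0 : s != [::] by rewrite -size_eq0 ss.
have [x xs xle] := @seq_le_prod R _ s (fun y => normc (z - y))
  (fun y => @normc_ge0 R _) s0.
exists x; first by rewrite ps rootZ ?lead_coef_eq0// root_prod_XsubC.
rewrite {2}ps hornerZ horner_prod.
rewrite /normc ComplexField.Normc.normcM normc_prod lp mulrC.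
rewrite ler_wpM2l ?normc_ge0// -ss (le_trans xle)//.
by under [leRHS]eq_bigr do rewrite hornerXsubC.
Qed.

End ZeroIntegral.

(** * Continuity of zeros in the coefficients *)

Section RootContinuity.
Variables (R : realType) (f : R -> R -> R).
Hypothesis cf : continuous (fun v : R * R => f v.1 v.2).
Implicit Types (p : nat -> {poly R[i]}) (z : R[i]).

Let normc z : R := ComplexField.Normc.normc z.

Lemma cvg_evalC (u : nat -> R[i]) z : ccvg u z ->
  evalC f (u n) @[n --> \oo] --> evalC f z.
Proof.
move=> [u1 u2]; rewrite /evalC.
exact: (@continuous2_cvg _ _ _ _ _ _ _ _ f (complex.Re z)
  (complex.Im z) (@cf (complex.Re z, complex.Im z)) u1 u2).
Qed.

Lemma ccvg_neq0 (u : nat -> R[i]) z : ccvg u z -> z != 0 ->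
  \forall n \near \oo, u n != 0.
Proof.
move=> /cvg_normc uz z0.
have : 0 < normc z by rewrite lt_def normc_ge0 normc_eq0 z0.
move=> zp; near=> n; rewrite -normc_eq0 gt_eqF//.
by near: n; exact: cvgr_gt uz _ zp.
Unshelve. all: by end_near. Qed.

Lemma ccvg_horner (m : nat) p (q : {poly R[i]}) z :
  (forall n, (size (p n) <= m)%N) -> (size q <= m)%N ->
  (forall j, ccvg (fun n => (p n)`_j) q`_j) ->
  ccvg (fun n => (p n).[z]) q.[z].
Proof.
move=> sp sq pq; rewrite (horner_coef_wide _ sq).
apply: (@eq_ccvg _ (fun n => \sum_(i < m) (p n)`_i * z ^+ i)).
  by near=> n; rewrite (horner_coef_wide _ (sp n)).
by apply: ccvg_sum => i; apply: ccvgM => //; exact: ccvg_cst.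
Unshelve. all: by end_near. Qed.

Lemma cvg_exprn_eq0 (m : nat) (u : nat -> R) : (forall n, 0 <= u n) ->
  u n ^+ m.+1 @[n --> \oo] --> (0 : R) -> u n @[n --> \oo] --> (0 : R).
Proof.
move=> u0 um; apply/cvgrPdist_lt => e e0.
move/cvgrPdist_lt: um => /(_ (e ^+ m.+1) (exprn_gt0 _ e0)); apply: filterS => n.
rewrite !sub0r !normrN ger0_norm ?exprn_ge0// ger0_norm//.
by rewrite ltr_pXn2r ?nnegrE// ltW.
Qed.

(* [`|(p n).[z]|] tends to [0] and is, up to the leading coefficient, the product
   of the distances from [z] to the roots of [p n], so the closest root works. *)
Lemma ccvg_root (m : nat) p (q : {poly R[i]}) z :
  (forall n, (size (p n) <= m.+2)%N) -> size q = m.+2 ->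
  (forall j, ccvg (fun n => (p n)`_j) q`_j) -> root q z ->
  exists2 x : nat -> R[i], ccvg x z & \forall n \near \oo, root (p n) (x n).
Proof.
move=> sp sq pq rz.
have qm : q`_m.+1 != 0.
  by have := lead_coef_eq0 q; rewrite /lead_coef sq -size_poly_eq0 sq => ->.
(* The default 0 is used where the top coefficient of [p n] vanishes, which happens for finitely
   many [n] only. *)
have /choice[x xP] : forall n, exists x, (p n)`_m.+1 != 0 -> root (p n) x /\
    normc (z - x) ^+ m.+1 * normc (p n)`_m.+1 <= normc (p n).[z].
  move=> n; have [//|pm] := eqVneq (p n)`_m.+1 0; first by exists 0.
  by have [x rx xle] := near_root z (sp n) pm; exists x.
have pm_near := ccvg_neq0 (pq m.+1) qm.
exists x; last by apply: filterS pm_near => n /xP[].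
have pz : normc (p n).[z] / normc (p n)`_m.+1 @[n --> \oo] --> (0 : R).
  have -> : (0 : R) = normc q.[z] / normc q`_m.+1.
    by rewrite (rootP rz) /normc ComplexField.Normc.normc0 mul0r.
  apply: cvgM; first by apply: cvg_normc; apply: ccvg_horner; rewrite ?sq.
  by apply: cvgV; [rewrite normc_eq0 | exact: cvg_normc].
apply: ccvg_normc0; apply: (@cvg_exprn_eq0 m) => [n|]; first exact: normc_ge0.
apply: (squeeze_cvgr _ (cvg_cst 0) pz).
apply: filterS pm_near => n pn; rewrite exprn_ge0 ?normc_ge0//=.
have [_] := xP n pn.
rewrite -ler_pdivlMr ?lt_def ?normc_ge0 ?normc_eq0 ?pn//.
by rewrite -[x n - z]opprB normcE !raddfN !sqrrN -normcE.
Qed.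

(** Synthetic division: [q_j = p_(j+1) + x q_(j+1)] determines the quotient from its top coefficient
    downwards by sums and products, which preserve limits. *)
Lemma ccvg_coef_quotient (m : nat) p (q : nat -> {poly R[i]}) (p0 q0 : {poly R[i]})
    (x : nat -> R[i]) z :
  ccvg x z -> (forall n, (size (q n) <= m)%N) -> (size q0 <= m)%N ->
  (\forall n \near \oo, p n = q n * ('X - (x n)%:P)) -> p0 = q0 * ('X - z%:P) ->
  (forall j, ccvg (fun n => (p n)`_j) p0`_j) ->
  forall j, ccvg (fun n => (q n)`_j) q0`_j.
Proof.
move=> xz sq sq0 pq pq0 pp0.
have coefM (r : {poly R[i]}) (y : R[i]) j :
    r`_j = (r * ('X - y%:P))`_j.+1 + r`_j.+1 * y.
  by rewrite mulrBr coefB coefMX coefMC subrK.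
(* Descending induction on [j], started at [j >= m], where all coefficients are 0. *)
suff H k j : (m <= j + k)%N -> ccvg (fun n => (q n)`_j) q0`_j.
  by move=> j; apply: (H m); rewrite leq_addl.
elim: k j => [|k IH] j mj.
  rewrite addn0 in mj; rewrite nth_default ?(leq_trans sq0)//.
  apply: (@eq_ccvg _ (fun=> 0)); last exact: ccvg_cst.
  by near=> n; rewrite nth_default// (leq_trans (sq n)).
rewrite (coefM q0 z) -pq0.
apply: (@eq_ccvg _ (fun n => (p n)`_j.+1 + (q n)`_j.+1 * x n)).
  by apply: filterS pq => n ->; rewrite -coefM.
by apply: ccvgD => //; apply: ccvgM => //; apply: IH; rewrite addSnnS.
Unshelve. all: by end_near. Qed.

(* Induction on the degree: divide [p n] by [X - x_n] and the limit by [X - z],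
   where the roots [x_n] of [p n] converge to the root [z] of the limit. *)
Lemma cvg_zero_int (m : nat) p (p0 : {poly R[i]}) :
  (forall n, (size (p n) <= m.+1)%N) -> size p0 = m.+1 ->
  (forall j, ccvg (fun n => (p n)`_j) p0`_j) ->
  zero_int f (p n) @[n --> \oo] --> zero_int f p0.
Proof.
elim: m p p0 => [|m IH] p p0 sp sp0 pp0.
  rewrite zero_int_const ?sp0//.
  under eq_fun do rewrite zero_int_const//.
  exact: cvg_cst.
have /closed_rootP[z rz] : size p0 != 1 by rewrite sp0.
have [x xz rx] := @ccvg_root m p p0 z sp sp0 pp0 rz.
have p0_neq0 : p0 != 0 by rewrite -size_poly_eq0 sp0.
(* The division is exact once [x n] is a root of [p n], hence for large [n]; the size bound [sq]
   holds for every [n], as the induction hypothesis requires. *)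
pose q n := p n %/ ('X - (x n)%:P); pose q0 := p0 %/ ('X - z%:P).
have pq0 : p0 = q0 * ('X - z%:P) by rewrite /q0 divpK// dvdp_XsubCl.
have pq : \forall n \near \oo, p n = q n * ('X - (x n)%:P).
  by apply: filterS rx => n rn; rewrite /q divpK// dvdp_XsubCl.
have sq n : (size (q n) <= m.+1)%N.
  rewrite size_divp ?polyXsubC_eq0// size_XsubC subn1 -ltnS.
  by case: (size _) (sp n).
have sq0 : size q0 = m.+1 by rewrite size_divp ?polyXsubC_eq0// size_XsubC sp0 subn1.
have q0_neq0 : q0 != 0 by rewrite -size_poly_eq0 sq0.
have qq0 := @ccvg_coef_quotient m.+1 p q p0 q0 x z xz sq _ pq pq0 pp0.
rewrite pq0 zero_int_MXsubC//.
have : evalC f (x n) + zero_int f (q n) @[n --> \oo] --> evalC f z + zero_int f q0.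
  by apply: cvgD; [exact: cvg_evalC | apply: IH => //; apply: qq0; rewrite sq0].
apply: cvg_trans; apply: near_eq_cvg.
(* The top coefficient of [q0] forces [q n != 0] for large [n], so that [zero_int_MXsubC]
   applies. *)
have qm : q0`_m != 0.
  by have := lead_coef_eq0 q0; rewrite /lead_coef sq0 => ->.
near=> n.
have qn0 : q n != 0.
  have : (q n)`_m != 0 by near: n; apply: (ccvg_neq0 _ qm); apply: qq0; rewrite sq0.
  by apply: contra => /eqP ->; rewrite coef0.
rewrite -zero_int_MXsubC//; congr zero_int.
by near: n; apply: filterS pq => n ->.
Unshelve. all: by end_near. Qed.

End RootContinuity.

(** * Measurability of the zero integral in random coefficients *)

Section MeasurabilityOfZeroIntegral.
Context (R : realType) (d : measure_display) (S : measurableType d).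

(** A preimage under [H \o g] is a countable union of fibres of [g], whatever [H] is. *)
Lemma measurable_comp_count (V : countType) (g : S -> V) (H : V -> R) :
  (forall v, measurable (g @^-1` [set v])) -> measurable_fun setT (H \o g).
Proof.
move=> mg _ Y mY; rewrite setTI.
have -> : (H \o g) @^-1` Y =
    \bigcup_v (if H v \in Y then g @^-1` [set v] else set0).
  apply/seteqP; split => s /=.
    by move=> Hs; exists (g s) => //; rewrite mem_set.
  by move=> [v _]; case: ifPn => // /set_mem Hv /= ->.
apply: countable_bigcupT_measurable => [|v]; first exact: countableP.
by case: ifPn.
Qed.

Definition grid (k : nat) (x : R) : R := (Num.floor (k.+1%:R * x))%:~R / k.+1%:R.

Lemma cvg_grid (x : R) : grid k x @[k --> \oo] --> x.
Proof.
have le_grid k : x - k.+1%:R^-1 <= grid k x <= x.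
  rewrite /grid; have /andP[h1 h2] := floor_itv (k.+1%:R * x).
  rewrite ler_pdivlMr ?ltr0Sn// ler_pdivrMr ?ltr0Sn// mulrBl mulVf ?pnatr_eq0//.
  rewrite [x * _]mulrC h1 andbT lerBlDr ltW//.
  by move: h2; rewrite intrD.
apply: (squeeze_cvgr _ _ (cvg_cst x)); first by near=> k; exact: le_grid.
rewrite -[X in _ --> X]subr0; apply: cvgB; first exact: cvg_cst.
exact: cvg_harmonic.
Unshelve. all: by end_near. Qed.

Lemma measurable_floor_preimage (a : S -> R) (v : int) :
  measurable_fun setT a -> measurable ((Num.floor \o a) @^-1` [set v]).
Proof.
move=> ma.
have -> : (Num.floor \o a) @^-1` [set v] = a @^-1` `[v%:~R, (v + 1)%:~R[%classic.
  by apply/seteqP; split => s /=; rewrite in_itv/= -floor_eq => /eqP.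
by rewrite -[X in measurable X]setTI; apply: ma => //; exact: measurable_itv.
Qed.

(* Where the leading coefficient vanishes the degree drops (induction); elsewhere
   root continuity makes the function a limit of its values at the coefficients
   rounded to a grid, which take countably many values. *)
Lemma measurable_zero_int (f : R -> R -> R) (m : nat) (a : nat -> S -> R * R) :
  continuous (fun v : R * R => f v.1 v.2) ->
  (forall j, measurable_fun setT (a j)) ->
  measurable_fun setT (fun s => zero_int f (\poly_(j < m) toC (a j s))).
Proof.
move=> cf ma.
have ma1 j : measurable_fun setT (fst \o a j).
  by have /measurable_fun_pairP[] := ma j.
have ma2 j : measurable_fun setT (snd \o a j).
  by have /measurable_fun_pairP[] := ma j.
have toC0 (v : R * R) : (toC v == 0) = (v == (0, 0)).
  by case: v => x y; rewrite eq_complex/= xpair_eqE.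
elim: m => [|m IH].
  apply: (eq_measurable_fun (cst 0 : S -> R)); last exact: measurable_cst.
  by move=> s _; rewrite zero_int_const// (leq_trans (size_poly _ _)).
pose D := [set s | toC (a m s) = 0].
have mD : measurable D.
  have -> : D = ((fst \o a m) @^-1` [set 0]) `&` ((snd \o a m) @^-1` [set 0]).
    apply/seteqP; split => s /=; rewrite /D/=.
      by move/eqP; rewrite toC0 => /eqP ->.
    by case: (a m s) => x y /= [-> ->].
  by apply: measurableI; rewrite -[X in measurable X]setTI;
    [apply: ma1 | apply: ma2] => //; exact: measurable_set1.
rewrite -(setUv D); apply/measurable_funU => //; first exact: measurableC.
split.
  apply: (eq_measurable_fun (fun s => zero_int f (\poly_(j < m) toC (a j s)))).
    move=> s /set_mem Ds; congr zero_int; apply/polyP => j.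
    rewrite !coef_poly [(j < m.+1)%N]ltnS [(j <= m)%N]leq_eqVlt; case: eqVneq => [->|//].
    by rewrite ltnn orTb Ds.
  exact: measurable_funS IH.
pose h k s := zero_int f (\poly_(j < m.+1)
  toC (grid k (a j s).1, grid k (a j s).2)).
apply: (@measurable_fun_cvg _ _ _ _ h) => [k|s Ds].
  apply: (@measurable_funS _ _ _ _ setT) => //.
  (* Recording the integer numerators of the rounded coefficients lands in a countable type. *)
  pose g s : {ffun 'I_m.+1 -> int * int} := [ffun j : 'I_m.+1 =>
    (Num.floor (k.+1%:R * (a j s).1), Num.floor (k.+1%:R * (a j s).2))].
  pose H (v : {ffun 'I_m.+1 -> int * int}) := zero_int f (\poly_(j < m.+1)
    toC ((v (inord j)).1%:~R / k.+1%:R, (v (inord j)).2%:~R / k.+1%:R)).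
  have -> : h k = H \o g.
    apply/funext => s; rewrite /h /H/=; congr zero_int; apply/polyP => j.
    by rewrite !coef_poly; case: ifPn => // jm; rewrite /g !ffunE/= inordK.
  apply: measurable_comp_count => v.
  have -> : g @^-1` [set v] = \bigcap_(j in [set: 'I_m.+1])
     ((Num.floor \o (fun s => k.+1%:R * (a j s).1)) @^-1` [set (v j).1] `&`
      (Num.floor \o (fun s => k.+1%:R * (a j s).2)) @^-1` [set (v j).2]).
    apply/seteqP; split => s /=.
      by move=> <- j _; rewrite /g ffunE.
    move=> Hs; apply/ffunP => j; have [/= e1 e2] := Hs j I.
    by rewrite /g ffunE e1 e2 -surjective_pairing.
  apply: fin_bigcap_measurable => [|j _]; first exact: finite_finset.
  by apply: measurableI; apply: measurable_floor_preimage;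
    apply: measurable_funM => //; [exact: ma1 | exact: ma2].
apply: (@cvg_zero_int _ _ cf m) => [k||j]; first exact: size_poly.
  by rewrite size_poly_eq//; exact/eqP.
rewrite coef_poly; under eq_fun do rewrite coef_poly.
case: ifPn => _; last exact: ccvg_cst.
by split; exact: cvg_grid.
Qed.

End MeasurabilityOfZeroIntegral.

(** * Product sigma-algebra on tuples, and blocks of consecutive variables *)

Section ShiftedBlocks.
Context (d' : measure_display) (E : measurableType d').

(** Unlike the one-coordinate cylinders, rectangles are closed under intersection, as uniqueness of
    measures requires of a generating family. *)
Lemma measurable_tuple_rectangles (n : nat) :
  @measurable _ (n.-tuple E) = <<s [set A | exists2 B : 'I_n -> set E,
    (forall i, measurable (B i)) &
    A = \big[setI/setT]_(i < n) ((fun t : n.-tuple E => tnth t i) @^-1` B i)] >>.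
Proof.
apply/seteqP; split.
  apply: smallest_sub; first exact: smallest_sigma_algebra.
  move=> A; rewrite -bigcup_seq/= => -[i _ [B mB <-]].
  (* A cylinder is a rectangle whose other sides are the whole space. *)
  apply: sub_gen_smallest; exists (fun j => if j == i then B else setT).
    by move=> j; case: ifP.
  rewrite setTI (bigD1 i)//= eqxx big1 ?setIT// => j /negbTE ->.
  exact: preimage_setT.
apply: smallest_sub; first exact: sigma_algebra_measurable.
move=> _ [B mB ->]; elim/big_ind: _ => //; first exact: measurableI.
move=> i _; rewrite -[X in measurable X]setTI.
by apply: measurable_tnth.
Qed.

Context (d : measure_display) (T : measurableType d).

Definition block (xi : nat -> T -> E) (n N : nat) (w : T) : n.-tuple E :=
  [tuple xi (N + i)%N w | i < n].

Lemma measurable_block (xi : nat -> T -> E) (n N : nat) :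
  (forall k, measurable_fun setT (xi k)) -> measurable_fun setT (block xi n N).
Proof.
move=> mxi; apply/measurable_fun_tnthP => i.
by apply: (eq_measurable_fun (xi (N + i)%N)) => // w _ /=; rewrite tnth_mktuple.
Qed.

End ShiftedBlocks.

(** * Shift invariance of the law of a block *)

Section StationaryBlocks.
Context (R : realType) (d : measure_display) (T : measurableType d)
  (P : probability T R) (xi : nat -> T -> R * R).
Hypothesis mxi : forall k, measurable_fun setT (xi k).
Hypothesis indep : mutual_indep P xi.
Hypothesis idistr : ident_distr P xi.

Let mblock n N : measurable_fun setT (block xi n N).
Proof. exact: measurable_block. Qed.

Lemma block_rectangle (m N : nat) (B : 'I_m.+1 -> set (R * R)) :
  (forall i, measurable (B i)) ->
  P (block xi m.+1 N @^-1`
      \big[setI/setT]_(i < m.+1) ((fun t => tnth t i) @^-1` B i)) =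
  (\prod_(i < m.+1) P (xi 0%N @^-1` B i))%E.
Proof.
(* [mutual_indep] takes sets indexed by the variables themselves: [B'] gives [xi (N + i)] the side
   [B i] and is total thanks to [inord]. *)
move=> mB; pose B' k := B (inord (k - N)%N).
have mB' k : measurable (B' k) by exact: mB.
have uI : uniq [seq (N + i)%N | i <- iota 0 m.+1].
  by rewrite map_inj_uniq ?iota_uniq//; exact: addnI.
have := indep uI mB'; rewrite !big_map -[iota 0 m.+1]/(index_iota 0 m.+1).
rewrite !big_mkord => PB.
transitivity (P (\big[setI/setT]_(i < m.+1) (xi (N + i)%N @^-1` B' (N + i)%N))).
  congr (P _); rewrite (big_morph _ (preimage_setI _) (preimage_setT _)).
  apply: eq_bigr => i _; rewrite /B' addKn inord_val.
  by apply/seteqP; split => w; rewrite /preimage/= tnth_mktuple.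
rewrite PB; apply: eq_bigr => i _.
by rewrite (idistr _ (mB' _)) /B' addKn inord_val.
Qed.

(** The two laws are finite and agree on rectangles by [block_rectangle], whose right-hand side is
    free of [N]; rectangles form a generating pi-system. *)
Lemma block_law (m N : nat) (A : set (m.+1.-tuple (R * R))) : measurable A ->
  P (block xi m.+1 N @^-1` A) = P (block xi m.+1 0 @^-1` A).
Proof.
move=> mA.
pose mX k := isMeasurableFun.Build _ _ _ _ _ (@mblock m.+1 k).
pose X k : {mfun T >-> m.+1.-tuple (R * R)} := HB.pack (block xi m.+1 k) (mX k).
rewrite -[LHS]/(distribution P (X N) A) -[RHS]/(distribution P (X 0%N) A).
apply: (measure_unique _ (fun=> setT) (measurable_tuple_rectangles (R * R)%type m.+1)) => //.
- move=> _ _ [B mB ->] [C mC ->]; exists (fun i => B i `&` C i).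
    by move=> i; exact: measurableI.
  by rewrite -big_split/=.
- by move=> _; exists (fun=> setT) => //; rewrite big1.
- by apply/seteqP; split => // t _; exists 0%N.
- move=> _ [B mB ->].
  set D := \big[_/_]_(_ < _) _.
  rewrite -[LHS]/(P (block xi m.+1 N @^-1` D)) -[RHS]/(P (block xi m.+1 0 @^-1` D)).
  by rewrite !block_rectangle.
- by move=> k; rewrite (le_lt_trans (probability_le1 _ _))// ltry.
Qed.

Lemma integral_block (m N : nat) (g : m.+1.-tuple (R * R) -> R) :
  measurable_fun setT g -> (exists M, forall t, `|g t| <= M) ->
  (\int[P]_w (g (block xi m.+1 N w))%:E = \int[P]_w (g (block xi m.+1 0 w))%:E)%E.
Proof.
move=> mg [M gM].
pose mX k := isMeasurableFun.Build _ _ _ _ _ (@mblock m.+1 k).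
pose X k : {mfun T >-> m.+1.-tuple (R * R)} := HB.pack (block xi m.+1 k) (mX k).
have Xint k : (\int[distribution P (X k)]_t (g t)%:E =
    \int[P]_w (g (block xi m.+1 k w))%:E)%E.
  rewrite integral_distribution//; first exact/measurable_EFinP.
  apply: (@measurable_bounded_integrable _ _ _ _ (g \o block xi m.+1 k)) => //.
  - by rewrite (le_lt_trans (probability_le1 _ _))// ltry.
  - exact: measurableT_comp (@mblock m.+1 k).
  - exists M; split; first exact: num_real.
    by move=> y My w _ /=; rewrite (le_trans (gM _))// ltW.
rewrite -!Xint; apply: eq_measure_integral => A mA _.
exact: block_law.
Qed.

End StationaryBlocks.

(** * Deterministic weights and their limits *)

Section WeightedPolynomials.
Variable R : realType.
Implicit Types (m : nat) (c : nat -> R) (x : nat -> R * R) (f : R -> R -> R).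

(** The weights [c] are kept apart from the coefficients [x], so that an index shift in [x] can be
    undone in law while [c] varies with [N]. *)
Definition wpoly m c x : {poly R[i]} :=
  \poly_(j < m.+1) toC (c j * (x j).1, c j * (x j).2).

Lemma eq_wpoly m c x y : (forall j, (j <= m)%N -> x j = y j) ->
  wpoly m c x = wpoly m c y.
Proof.
move=> xy; apply/polyP => j; rewrite !coef_poly; case: ifPn => // jm.
by rewrite xy.
Qed.

Lemma toC_scale (a : R) (v : R * R) : toC (a * v.1, a * v.2) = a%:C%C * toC v.
Proof. by rewrite /toC; apply/eqP; rewrite eq_complex/= !mul0r subr0 addr0 !eqxx. Qed.

Lemma toC_eq0 (v : R * R) : (toC v == 0) = (v == (0, 0)).
Proof. by case: v => x y; rewrite eq_complex/= xpair_eqE. Qed.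

(** The two conditions at index [m] give the limit polynomial degree exactly [m], so no zero escapes
    to infinity. *)
Lemma cvg_zero_int_wpoly m f (c : nat -> nat -> R) (c0 : nat -> R) x :
  continuous (fun v : R * R => f v.1 v.2) ->
  (forall j, (j <= m)%N -> c n j @[n --> \oo] --> c0 j) ->
  c0 m != 0 -> x m != (0, 0) ->
  zero_int f (wpoly m (c n) x) @[n --> \oo] --> zero_int f (wpoly m c0 x).
Proof.
move=> cf cc0 c0m xm; apply: (@cvg_zero_int _ _ cf m) => [k||j].
- exact: size_poly.
- rewrite size_poly_eq// toC_scale mulf_neq0 ?toC_eq0//.
  by rewrite (inj_eq (@complexI R)).
rewrite coef_poly; under eq_fun do rewrite coef_poly.
case: ifPn => jm; last exact: ccvg_cst.
by split; apply: cvgMl; exact: cc0.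
Qed.

Lemma measurable_wpoly m f c (d : measure_display) (S : measurableType d)
    (a : nat -> S -> R * R) :
  continuous (fun v : R * R => f v.1 v.2) ->
  (forall j, measurable_fun setT (a j)) ->
  measurable_fun setT (fun s => zero_int f (wpoly m c (a ^~ s))).
Proof.
move=> cf ma.
apply: (@measurable_zero_int _ _ _ f m.+1
  (fun j s => (c j * (a j s).1, c j * (a j s).2)) cf) => j.
have /measurable_fun_pairP[ma1 ma2] := ma j.
by apply: measurable_fun_pair; apply: measurable_funM.
Qed.

Lemma derivn_Kpoly m (N : nat) x : derivn N (Kpoly x (N + m)) =
  \poly_(j < m.+1) (toC (x (N + j)%N) *+ (N + j) ^_ N).
Proof.
apply/polyP => j; rewrite coef_derivn !coef_poly -[(N + m).+1]addnS ltn_add2l.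
by case: ifP => // _; rewrite mul0rn.
Qed.

Lemma ffact_addE (N j : nat) : ((N + j) ^_ N)%:R = (N + j)`!%:R / j`!%:R :> R.
Proof.
have := ffact_fact (leq_addr j N); rewrite addKn => <-.
by rewrite natrM mulfK// pnatr_eq0 -lt0n fact_gt0.
Qed.

(* The weights after division by [n! = (N + m)!]. *)
Definition weight m (N j : nat) : R := (N + j)`!%:R / (j`!%:R * (N + m)`!%:R).

Lemma toC_MnE (v : R * R) (k : nat) : toC v *+ k = k%:R%:C%C * toC v.
Proof.
have -> : k%:R%:C%C = k%:R :> R[i] by exact: (rmorph_nat (real_complex R)).
exact/esym/mulr_natl.
Qed.

Lemma zero_int_derivn_Kpoly m (N : nat) x f :
  zero_int f (derivn N (Kpoly x (N + m))) =
  zero_int f (wpoly m (weight m N) (fun j => x (N + j)%N)).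
Proof.
have M0 : (N + m)`!%:R != 0 :> R by rewrite pnatr_eq0 -lt0n fact_gt0.
rewrite derivn_Kpoly -[RHS](@zero_intZ _ f (N + m)`!%:R%:C%C); last first.
  by rewrite (inj_eq (@complexI R)).
congr zero_int; apply/polyP => j; rewrite coefZ !coef_poly.
case: ifP => _; last by rewrite mulr0.
rewrite toC_scale toC_MnE mulrA -rmorphM/= ffact_addE /weight.
congr (_%:C%C * _); rewrite invfM mulrCA; congr (_ * _).
by rewrite mulrCA mulfV// mulr1.
Qed.

(* The weights after the substitution [z / n] and division by [N!]. *)
Definition scaled_weight m (N j : nat) : R :=
  (N + j)`!%:R / (j`!%:R * N`!%:R * (N + m)%:R ^+ j).

(** The substitution [z / (N + m)] puts [(N + m)^-j] on the coefficient of index [j]; [0 < m] keeps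
    the scale nonzero even at [N = 0]. *)
Lemma scaled_zero_int_derivn_Kpoly m (N : nat) x f : (0 < m)%N ->
  scaled_zero_int (N + m)%:R f (derivn N (Kpoly x (N + m))) =
  zero_int f (wpoly m (scaled_weight m N) (fun j => x (N + j)%N)).
Proof.
move=> m0; have N0 : N`!%:R != 0 :> R by rewrite pnatr_eq0 -lt0n fact_gt0.
rewrite zero_int_scale; last by rewrite pnatr_eq0 addn_eq0 negb_and -!lt0n m0 orbT.
rewrite derivn_Kpoly -[RHS](@zero_intZ _ f N`!%:R%:C%C); last first.
  by rewrite (inj_eq (@complexI R)).
congr zero_int; rewrite poly_def raddf_sum/= /wpoly poly_def scaler_sumr.
apply: eq_bigr => j _; rewrite comp_polyZ rmorphXn/= comp_polyX exprZn !scalerA.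
congr (_ *: _); rewrite toC_scale toC_MnE mulrA -rmorphM/= mulrAC -rmorphXn -rmorphM/=.
congr (_%:C%C * _); rewrite ffact_addE /scaled_weight exprVn !invfM.
by rewrite [j`!%:R^-1 / _]mulrC -!mulrA [RHS]mulrCA mulVKf.
Qed.

Lemma fKpolyE m x : fKpoly x m = wpoly m (fun j => j`!%:R^-1) x.
Proof.
apply/polyP => j; rewrite !coef_poly; case: ifP => // _.
by rewrite toC_scale fmorphV rmorph_nat mulrC.
Qed.

(** The polynomial is a nonzero multiple of [X^m], with [m] roots at the origin. *)
Lemma zero_int_wpoly_lead m f x : x m != (0, 0) ->
  zero_int f (wpoly m (fun j => (j == m)%:R / m`!%:R) x) = m%:R * f 0 0.
Proof.
move=> xm; have M0 : m`!%:R != 0 :> R by rewrite pnatr_eq0 -lt0n fact_gt0.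
have -> : wpoly m (fun j => (j == m)%:R / m`!%:R) x =
    ((m`!%:R)^-1%:C%C * toC (x m)) *: \prod_(z <- nseq m 0) ('X - z%:P).
  rewrite big_nseq subr0 -Monoid.iteropE; apply/polyP => j.
  rewrite coefZ coefXn coef_poly toC_scale ltnS.
  have [->|jm] := eqVneq j m; first by rewrite leqnn mul1r mulr1.
  by rewrite mul0r mul0r mulr0; case: ifP.
rewrite zero_int_prod; last first.
  by rewrite mulf_neq0 ?toC_eq0// (inj_eq (@complexI R)) invr_eq0.
by rewrite big_nseq iter_addr_0 mulr_natl.
Qed.

(** At [j = m] the large factorials cancel; for [j < m] the factor [N + m] of [(N + m)!] is left
    over, whence the bound [1 / (N + 1)]. *)
Lemma cvg_weight m j : (j <= m)%N ->
  weight m N j @[N --> \oo] --> ((j == m)%:R / m`!%:R : R).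
Proof.
rewrite leq_eqVlt => /orP[/eqP ->|jm].
  rewrite eqxx mul1r; apply: cvg_near_cst; near=> N.
  by rewrite /weight mulrC invfM -mulrA mulVf ?mulr1// pnatr_eq0 -lt0n fact_gt0.
rewrite (ltn_eqF jm) mul0r.
apply: (squeeze_cvgr _ (cvg_cst 0) (@cvg_harmonic R)).
near=> N; rewrite /weight divr_ge0 ?mulr_ge0 ?ler0n//=.
have fj : (0 < j`!%:R :> R) by rewrite ltr0n fact_gt0.
have fN : (0 < (N + m)`!%:R :> R) by rewrite ltr0n fact_gt0.
rewrite ler_pdivrMr ?mulr_gt0// /harmonic/= mulrC ler_pdivlMr ?ltr0Sn//.
rewrite -!natrM ler_nat (@leq_trans (N + m)`!)//; last by rewrite leq_pmull// fact_gt0.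
case: m jm {fN} => // m; rewrite ltnS => jm.
rewrite addnS factS mulnC leq_mul ?ltnS ?leq_addr//.
by rewrite leq_fact// leq_add2l.
Unshelve. all: by end_near. Qed.

(** Apart from [1 / j!], the weight is the product of [(N + i) / (N + m)] over [1 <= i <= j]: a
    fixed number of factors, each tending to 1. *)
Lemma cvg_scaled_weight m j : (0 < m)%N ->
  scaled_weight m N j @[N --> \oo] --> (j`!%:R^-1 : R).
Proof.
move=> m0.
pose r j N : R := (N + j)`!%:R / (N`!%:R * (N + m)%:R ^+ j).
suff rcvg : r j N @[N --> \oo] --> (1 : R).
  rewrite -[X in _ --> X]mul1r.
  rewrite (_ : (fun N => _) = fun N => r j N * j`!%:R^-1).
    by apply: cvgMl.
  apply/funext => N; rewrite /r /scaled_weight -[RHS]mulrA -invfM.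
  by congr (_ / _); rewrite -mulrA mulrC.
elim: j => [|j IH].
  apply: cvg_near_cst; near=> N.
  by rewrite /r addn0 expr0 mulr1 mulfV// pnatr_eq0 -lt0n fact_gt0.
have Nm0 N : (N + m)%:R != 0 :> R.
  by rewrite pnatr_eq0 addn_eq0 negb_and -!lt0n m0 orbT.
rewrite -[X in _ --> X]mul1r.
rewrite (_ : r j.+1 = fun N => r j N * (1 + (j.+1%:R - m%:R) / (N + m)%:R)).
  apply: cvgM => //; rewrite -[X in _ --> X]addr0; apply: cvgD; first exact: cvg_cst.
  rewrite -[X in _ --> X](mulr0 (j.+1%:R - m%:R)); apply: cvgMr.
  (* [1 / (N + m)] is the harmonic sequence [1 / (N + 1)] shifted by [m - 1]. *)
  have := @cvg_harmonic R; rewrite -(cvg_shiftn m.-1).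
  apply: cvg_trans; apply: near_eq_cvg; near=> N.
  by rewrite /harmonic/= -addnS prednK.
apply/funext => N; have e : 1 + (j.+1%:R - m%:R) / (N + m)%:R =
    (N + j.+1)%:R / (N + m)%:R :> R.
  apply: (mulIf (Nm0 N)); rewrite mulrDl !divfK// mul1r !natrD.
  by rewrite addrACA subrr addr0.
rewrite e /r exprSr addnS factS natrM [RHS]mulrACA -invfM.
by congr (_ / _); [rewrite mulrC | rewrite mulrA].
Unshelve. all: by end_near. Qed.

End WeightedPolynomials.

(** * From almost sure convergence to convergence in law and in probability *)

Section Convergence.
Context (R : realType) (d : measure_display) (T : measurableType d)
  (P : probability T R).

(** The factor [a] will be the normalisation [1 / m]. Measurability is asked only eventually because
    the weighted form of [Y n] is available for [n >= m]. *)
Lemma cvg_in_distr_const_prob (Y : nat -> T -> R) (Z : T -> R) (a b eps : R) :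
  (\forall n \near \oo, measurable_fun setT (Y n)) -> measurable_fun setT Z ->
  cvg_in_distr P Y Z -> {ae P, forall w, a * Z w = b} -> 0 < eps ->
  P [set w | eps < `|a * Y n w - b|] @[n --> \oo] --> 0%E.
Proof.
move=> mY mZ YZ Zb e0.
(* Markov's inequality with a truncation that is a legal test for [YZ]. *)
pose g (y : R) : R := Num.min 1 (`|a * y - b| / eps).
have g0 y : 0 <= g y by rewrite le_min ler01 divr_ge0// ltW.
have g1 y : g y <= 1 by rewrite ge_min lexx.
have cg : continuous g.
  move=> y; apply: (@continuous_min R R (cst 1) (fun y => `|a * y - b| / eps)).
    exact: cvg_cst.
  apply: cvgMl; apply: cvg_norm; apply: cvgB; last exact: cvg_cst.
  by apply: cvgMr; exact: cvg_id.
have mg : measurable_fun setT g by exact: continuous_measurable_fun.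
have gle y : `|g y| <= 1 by rewrite ger0_norm.
have gZ : (\int[P]_w (g (Z w))%:E = 0)%E.
  rewrite -[RHS](integral0 P setT); apply: ae_eq_integral => //.
    by apply/measurable_EFinP; exact: measurableT_comp mg mZ.
  apply: filterS Zb => w Zw _ /=; rewrite /g Zw subrr normr0 mul0r.
  by rewrite min_r.
have := YZ g cg (ex_intro _ 1 gle); rewrite gZ => gY.
apply: (squeeze_cvge _ (cvg_cst 0%E) gY).
near=> n; rewrite measure_ge0/=.
have mYn : measurable_fun setT (Y n) by near: n.
have mA : measurable [set w | eps < `|a * Y n w - b|].
  have mf : measurable_fun setT (fun w => `|a * Y n w - b|).
    apply: measurableT_comp => //; apply: measurable_funB => //.
    by apply: measurable_funM.
  rewrite -[X in measurable X]setTI.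
  have -> : [set w | eps < `|a * Y n w - b|] =
     (fun w => `|a * Y n w - b|) @^-1` `]eps, +oo[%classic.
    by apply/seteqP; split => w /=; rewrite in_itv/= andbT.
  by apply: mf => //; exact: measurable_itv.
rewrite -[X in (P X <= _)%E]setIT -integral_indic//.
apply: ge0_le_integral => //.
- exact/measurable_EFinP/measurable_indic.
- by apply/measurable_EFinP; exact: measurableT_comp mg mYn.
move=> w _; rewrite lee_fin indicE; have [/set_mem/= Aw|_] := boolP (w \in _).
  by rewrite le_min lexx/= ler_pdivlMr// mul1r ltW.
exact: g0.
Unshelve. all: by end_near. Qed.

Variable xi : nat -> T -> R * R.
Hypothesis mxi : forall k, measurable_fun setT (xi k).
Hypothesis indep : mutual_indep P xi.
Hypothesis idistr : ident_distr P xi.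
Hypothesis xi_neq0 : P (xi 0%N @^-1` [set (0, 0)]) = 0%E.

Lemma ae_xi_neq0 (m : nat) : {ae P, forall w, xi m w != (0, 0)}.
Proof.
have mset : measurable [set (0, 0) : R * R].
  have -> : [set (0, 0)] = [set 0] `*` [set 0] :> set (R * R).
    by apply/seteqP; split => -[x y] /= [-> ->].
  exact: measurableX.
exists (xi m @^-1` [set (0, 0)]); split.
- by rewrite -[X in measurable X]setTI; exact: mxi.
- by rewrite idistr.
- by move=> w /= /negP; rewrite negbK => /eqP.
Qed.

(** Only [m + 1] coefficients enter, so the integrand is a bounded measurable function [G] of a
    block, whose law does not depend on [N]. *)
Lemma integral_shift_wpoly (m N : nat) (f : R -> R -> R) (c : nat -> R)
    (g : R -> R) :
  continuous (fun v : R * R => f v.1 v.2) -> continuous g ->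
  (exists M, forall x, `|g x| <= M) ->
  (\int[P]_w (g (zero_int f (wpoly m c (fun j => xi (N + j)%N w))))%:E =
   \int[P]_w (g (zero_int f (wpoly m c (xi ^~ w))))%:E)%E.
Proof.
move=> cf cg [M gM].
pose G (t : m.+1.-tuple (R * R)) :=
  g (zero_int f (wpoly m c (fun j => tnth t (inord j)))).
have GE k w : G (block xi m.+1 k w) =
    g (zero_int f (wpoly m c (fun j => xi (k + j)%N w))).
  congr (g (zero_int f _)); apply: eq_wpoly => j jm.
  by rewrite tnth_mktuple inordK.
have mG : measurable_fun setT G.
  apply: measurableT_comp; first exact: continuous_measurable_fun.
  apply: (@measurable_wpoly _ m f c _ (m.+1.-tuple (R * R))
    (fun j t => tnth t (inord j)) cf) => j.
  exact: measurable_tnth.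
under eq_integral do rewrite -GE.
rewrite (integral_block mxi indep idistr)//; last by exists M => t; exact: gM.
by apply: eq_integral => w _; rewrite GE.
Qed.

(** Once [xi (N + j)] is replaced by [xi j] under the integral, the coefficients no longer move with
    [N], and root continuity applies at almost every [w]. *)
Lemma cvg_in_distr_wpoly (m : nat) (f : R -> R -> R) (c : nat -> nat -> R)
    (c0 : nat -> R) (Y : nat -> T -> R) :
  continuous (fun v : R * R => f v.1 v.2) ->
  (forall N w, Y (N + m)%N w =
    zero_int f (wpoly m (c N) (fun j => xi (N + j)%N w))) ->
  (forall j, (j <= m)%N -> c N j @[N --> \oo] --> c0 j) -> c0 m != 0 ->
  cvg_in_distr P Y (fun w => zero_int f (wpoly m c0 (xi ^~ w))).
Proof.
move=> cf YE cc0 c0m g cg [M gM]; rewrite -(cvg_shiftn m)/=.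
rewrite (_ : (fun N => _) =
    fun N => (\int[P]_w (g (zero_int f (wpoly m (c N) (xi ^~ w))))%:E)%E); last first.
  apply/funext => N; rewrite -(@integral_shift_wpoly m N)//; last by exists M.
  by apply: eq_integral => w _; rewrite YE.
have mg : measurable_fun setT g by exact: continuous_measurable_fun.
have mz (b : nat -> R) : measurable_fun setT
    (fun w => (g (zero_int f (wpoly m b (xi ^~ w))))%:E).
  by apply/measurable_EFinP; apply: measurableT_comp mg _; exact: measurable_wpoly.
(* The bound [M] of [g] dominates; pointwise convergence holds off the null set where [xi m]
   vanishes. *)
have [||| _ _ //] := @dominated_convergence _ _ _ P setT measurableT
  (fun N w => (g (zero_int f (wpoly m (c N) (xi ^~ w))))%:E)
  (fun w => (g (zero_int f (wpoly m c0 (xi ^~ w))))%:E) (cst M%:E)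
  (fun N => mz (c N)) (mz c0).
- apply: filterS (ae_xi_neq0 m) => w xw _.
  apply: cvg_EFin; first by near=> N.
  by apply: (cvg_comp _ _ (cvg_zero_int_wpoly cf cc0 c0m xw)); exact: cg.
- exact: finite_measure_integrable_cst.
- by apply: aeW => w N _ /=; rewrite lee_fin.
Unshelve. all: by end_near. Qed.

End Convergence.

Unset Implicit Arguments.
Set Strict Implicit.

Theorem theorem4 (R : realType) (d : measure_display) (T : measurableType d)
    (P : probability T R) (xi : nat -> T -> (R * R)%type) (m : nat) :
  (forall k, measurable_fun setT (xi k)) ->
  mutual_indep P xi -> ident_distr P xi ->
  nondegenerate_rv P (xi 0%N) ->
  P (xi 0%N @^-1` [set (0, 0)]) = 0%E ->
  (\int[P]_w (ln (1 + cabs (xi 0%N w)))%:E < +oo)%E ->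
  (0 < m)%N ->
  (* D_n = m, N_n = n - m; mu^K_{D_n} = zeros of the (n-m)-th derivative of K_n *)
  (forall f, test_fun f ->
     cvg_in_prob P
       (fun n w => m%:R^-1 * zero_int f (derivn (n - m) (Kpoly (xi ^~ w) n)))
       (f 0 0)) /\
  (forall f, test_fun f ->
     cvg_in_distr P
       (fun n w => scaled_zero_int n%:R f (derivn (n - m) (Kpoly (xi ^~ w) n)))
       (fun w => zero_int f (fKpoly (xi ^~ w) m))).
Proof.
move=> mxi indep idistr _ xi0 _ m0.
have fact_neq0 j : j`!%:R != 0 :> R by rewrite pnatr_eq0 -lt0n fact_gt0.
(* The empty list of derivatives gives continuity of [f] itself. *)
split=> f [sf _]; have [/= cf _] := sf [::].
- have YE N w : zero_int f (derivn (N + m - m) (Kpoly (xi ^~ w) (N + m))) =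
      zero_int f (wpoly m (weight R m N) (fun j => xi (N + j)%N w)).
    by rewrite addnK zero_int_derivn_Kpoly.
  pose c0 j : R := (j == m)%:R / m`!%:R.
  have c0m : c0 m != 0 by rewrite /c0 eqxx mul1r invr_eq0.
  have YZ := @cvg_in_distr_wpoly _ _ _ _ _ mxi indep idistr xi0 m f (weight R m) c0
    (fun n w => zero_int f (derivn (n - m) (Kpoly (xi ^~ w) n))) cf YE
    (@cvg_weight R m) c0m.
  move=> eps; apply: (cvg_in_distr_const_prob _ _ YZ).
  + exists m => // n /= mn; rewrite -(subnK mn).
    apply: (eq_measurable_fun (fun w => zero_int f (wpoly m (weight R m (n - m))
        (fun j => xi (n - m + j)%N w)))); first by move=> w _; rewrite YE.
    exact: measurable_wpoly.
  + exact: measurable_wpoly.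
  (* Where [xi m] is nonzero, the limit has all [m] zeros at 0, and their average is [f 0 0]. *)
  + apply: filterS (ae_xi_neq0 mxi idistr xi0 m) => w xw.
    by rewrite zero_int_wpoly_lead// mulKf// pnatr_eq0 -lt0n.
- rewrite (_ : (fun w => zero_int f (fKpoly (xi ^~ w) m)) =
      fun w => zero_int f (wpoly m (fun j => j`!%:R^-1) (xi ^~ w))); last first.
    by apply/funext => w; rewrite fKpolyE.
  apply: (cvg_in_distr_wpoly mxi indep idistr xi0 cf (c := scaled_weight R m)) => //.
  + by move=> N w; rewrite addnK scaled_zero_int_derivn_Kpoly.
  + by move=> j _; exact: cvg_scaled_weight.
Qed.
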